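(* Let $\ell>0$, $\nu>0$, $\Delta\ge 0$, and let $h=\ell/N$ for a positive integer $N$. Let $u=(u_1,u_2,u_3)$, with $u(\cdot,t)\in U^3$ for each $t$, be a solution of the incompressible Navier–Stokes equations on the periodic box $[0,\ell]^3$, that is, $\partial_ju_j=0$ and, for $i\in\{1,2,3\}$, $$\partial_tu_i+\partial_jr_{ij}(u)=0,\qquad r_{ij}(u):=\pi_{ij\alpha\beta}\,\sigma_{\alpha\beta}(u).$$ Define the projected double-filtered velocity $\bar u^{\Delta,h,\pi}_i:=\pi^h_{ij}f^hf^\Delta u_j$. Then, for each $i\in\{1,2,3\}$, $$\partial_t\bar u^{\Delta,h,\pi}_i+\partial^h_j\,\pi^h_{ij\alpha\beta}\,\sigma^h_{\alpha\beta}\big(\bar u^{\Delta,h,\pi}\big)=-\,\partial^h_j\,\pi^h_{ij\alpha\beta}\,\xi^{\Delta,h,\pi}_{\alpha\beta}(u),$$ where the residual stress tensor $\xi^{\Delta,h,\pi}$ is given, with no sum over $j$, by $$\xi^{\Delta,h,\pi}_{ij}(u):=f^{h,j}f^\Delta\big(r_{ij}(u)\big)-\sigma^h_{ij}\big(\bar u^{\Delta,h,\pi}\big).$$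
   Context: Repeated indices are summed over $\{1,2,3\}$ unless stated otherwise. $U$ is the space of real scalar fields on $\mathbb{R}^3$ that are $\ell$-periodic in each coordinate, taken sufficiently regular (e.g. smooth) that all derivatives and integrals exist; $u$ is sufficiently regular in time to commute $\partial_t$ with the spatial operators. $\partial_i=\partial/\partial x_i$, and $e_1,e_2,e_3$ are the unit coordinate vectors. Continuous stress and projector: $\sigma_{ij}(u)=u_iu_j-\nu(\partial_ju_i+\partial_iu_j)$ and $\pi_{ij\alpha\beta}=\delta_{i\alpha}\delta_{j\beta}-\delta_{ij}(\partial_k\partial_k)^\dagger\partial_\alpha\partial_\beta$, where $(\partial_k\partial_k)^\dagger$ maps a zero-mean field $\varphi\in U$ to the unique $p\in U$ with $\partial_k\partial_kp=\varphi$ and $\int_{[0,\ell]^3}p\,\mathrm{d}V=0$. Thus $r_{ij}(u)=\sigma_{ij}(u)+p\,\delta_{ij}$ with $p$ the zero-mean pressure. Discrete operators: $\partial^h_iu(x)=\frac1h[u(x+\frac h2e_i)-u(x-\frac h2e_i)]$ and $\eta^h_iu(x)=\frac12[u(x-\frac h2e_i)+u(x+\frac h2e_i)]$. The numerical stress is (no sums) $\sigma^h_{ij}(u)=(\eta^h_ju_i)(\eta^h_iu_j)-\nu(\partial^h_ju_i+\partial^h_iu_j)$. Discrete projectors: $\pi^h_{ij}=\delta_{ij}-\partial^h_i(\partial^h_k\partial^h_k)^\dagger\partial^h_j$ acting on vector fields, and $\pi^h_{ij\alpha\beta}=\delta_{i\alpha}\delta_{j\beta}-\delta_{ij}(\partial^h_k\partial^h_k)^\dagger\partial^h_\alpha\partial^h_\beta$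 acting on tensor fields. Here $(\partial^h_k\partial^h_k)^\dagger$ maps a field $\varphi$ (whose average over every translated periodic grid $x+h\mathbb{Z}^3$ modulo $\ell\mathbb{Z}^3$ is zero) to the unique field $p$ with $\partial^h_k\partial^h_kp=\varphi$ and zero average over every translated grid $x+h\mathbb{Z}^3$ modulo $\ell\mathbb{Z}^3$. Filters: $f^\Delta u(x)=\int_{\mathbb{R}^3}G^\Delta(x-y)u(y)\,\mathrm{d}y$ with an integrable kernel $G^\Delta$ (the identity if $\Delta=0$), applied componentwise to vectors and tensors. With $g^h_iu(x)=\frac1h\int_{-h/2}^{h/2}u(x+\alpha e_i)\,\mathrm{d}\alpha$, the volume-averaging filter is $f^h=g^h_1g^h_2g^h_3$ and the surface-averaging filters are $f^{h,1}=g^h_2g^h_3$, $f^{h,2}=g^h_1g^h_3$, $f^{h,3}=g^h_1g^h_2$. *)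

(* Defs.v *)
From HB Require Import structures.
From mathcomp Require Import all_boot all_order all_algebra.
From mathcomp Require Import all_classical all_reals all_analysis.

Set Implicit Arguments.
Unset Strict Implicit.
Unset Printing Implicit Defensive.

Import Order.TTheory GRing.Theory Num.Theory.
Import numFieldNormedType.Exports.
Local Open Scope classical_set_scope.
Local Open Scope ring_scope.

Definition sfield (R : realType) := 'rV[R]_3 -> R.
Definition vfield (R : realType) := 'I_3 -> sfield R.
Definition tfield (R : realType) := 'I_3 -> 'I_3 -> sfield R.

Section Fields.
Variable R : realType.
Implicit Types (phi p : sfield R) (u : vfield R) (s : tfield R) (x : 'rV[R]_3).

Definition unitv (i : 'I_3) : 'rV[R]_3 := delta_mx 0 i.

Definition kron (i j : 'I_3) : R := (i == j)%:R.

Definition pd (i : 'I_3) phi : sfield R := fun x => 'D_(unitv i) phi x.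

(* C^oo: all iterated partial derivatives exist and are continuous. *)
Definition smooth phi := forall l : seq 'I_3,
  let psi := foldr pd phi l in
  continuous psi /\ forall i x, derivable psi x (unitv i).

Definition periodic (ell : R) phi :=
  forall i x, phi (x + ell *: unitv i) = phi x.

Definition U (ell : R) : set (sfield R) :=
  [set phi | periodic ell phi /\ smooth phi].

(* Lebesgue measure on R^3, carried by (R * R) * R because row vectors have no
   product measure in the library; [pt3] identifies the two spaces. *)
Definition leb3 : set (R * R * R) -> \bar R :=
  ((@lebesgue_measure R \x @lebesgue_measure R) \x @lebesgue_measure R)%E.

Definition pt3 (y : R * R * R) : 'rV[R]_3 :=
  \row_k [:: y.1.1; y.1.2; y.2]`_k.

Definition box (ell : R) : set (R * R * R) :=
  (`[0, ell] `*` `[0, ell]) `*` `[0, ell].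

Definition box_integral (ell : R) phi : R :=
  \int[leb3]_(y in box ell) phi (pt3 y).

Definition laplacian phi : sfield R := fun x => \sum_(k < 3) pd k (pd k phi) x.

(* The default value 0 is irrelevant on zero-mean elements of U, where p
   exists and is unique. *)
Definition laplacian_inv (ell : R) phi : sfield R :=
  xget (fun=> 0) [set p | [/\ U ell p, forall x, laplacian p x = phi x
                            & box_integral ell p = 0]].

Definition sigma (nu : R) u : tfield R := fun i j x =>
  u i x * u j x - nu * (pd j (u i) x + pd i (u j) x).

Definition tproj (ell : R) (i j a b : 'I_3) phi
    : sfield R := fun x =>
  kron i a * kron j b * phi x
  - kron i j * laplacian_inv ell (pd a (pd b phi)) x.

Definition stress (ell nu : R) u : tfield R := fun i j x =>
  \sum_(a < 3) \sum_(b < 3) tproj ell i j a b (sigma nu u a b) x.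

Definition pdh (h : R) (i : 'I_3) phi : sfield R := fun x =>
  h^-1 * (phi (x + (h / 2) *: unitv i) - phi (x - (h / 2) *: unitv i)).

Definition etah (h : R) (i : 'I_3) phi : sfield R := fun x =>
  2^-1 * (phi (x - (h / 2) *: unitv i) + phi (x + (h / 2) *: unitv i)).

Definition sigmah (nu h : R) u : tfield R := fun i j x =>
  etah h j (u i) x * etah h i (u j) x
  - nu * (pdh h j (u i) x + pdh h i (u j) x).

Definition laplacianh (h : R) phi : sfield R :=
  fun x => \sum_(k < 3) pdh h k (pdh h k phi) x.

(* When h = ell / N, the N ^ 3 points x + h m, 0 <= m_k < N, represent
   x + h Z^3 modulo ell Z^3. *)
Definition grid_average (h : R) (N : nat) phi : sfield R := fun x =>
  (N ^ 3)%:R^-1 * \sum_(m : {ffun 'I_3 -> 'I_N})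
    phi (x + h *: \row_k (m k)%:R).

(* On each grid p is determined by finitely many values of phi, so no
   regularity is imposed on it: a smooth phi yields a smooth p. As above, the
   default value is irrelevant when phi is periodic with zero grid averages. *)
Definition laplacianh_inv (ell h : R) (N : nat) phi : sfield R :=
  xget (fun=> 0) [set p | [/\ periodic ell p,
                              forall x, laplacianh h p x = phi x
                            & forall x, grid_average h N p x = 0]].

Definition vprojh (ell h : R) (N : nat) (i j : 'I_3) phi : sfield R := fun x =>
  kron i j * phi x - pdh h i (laplacianh_inv ell h N (pdh h j phi)) x.

Definition tprojh (ell h : R) (N : nat) (i j a b : 'I_3) phi
    : sfield R := fun x =>
  kron i a * kron j b * phi x
  - kron i j * laplacianh_inv ell h N (pdh h a (pdh h b phi)) x.

Definition tprojh_apply (ell h : R) (N : nat) s : tfield R := fun i j x =>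
  \sum_(a < 3) \sum_(b < 3) tprojh ell h N i j a b (s a b) x.

Definition integrable_kernel (G : sfield R) :=
  leb3.-integrable setT (fun y => (G (pt3 y))%:E).

Definition convfilter (G : R -> sfield R) (Delta : R) phi : sfield R :=
  if Delta == 0 then phi
  else fun x => \int[leb3]_y (G Delta (x - pt3 y) * phi (pt3 y)).

Definition gh (h : R) (i : 'I_3) phi : sfield R := fun x =>
  h^-1 * \int[@lebesgue_measure R]_(a in `[- (h / 2), h / 2])
    phi (x + a *: unitv i).

Definition dir1 : 'I_3 := @Ordinal 3 0 isT.
Definition dir2 : 'I_3 := @Ordinal 3 1 isT.
Definition dir3 : 'I_3 := @Ordinal 3 2 isT.

Definition volfilter (h : R) phi : sfield R :=
  gh h dir1 (gh h dir2 (gh h dir3 phi)).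

Definition surffilter (h : R) (j : 'I_3) phi : sfield R :=
  if j == dir1 then gh h dir2 (gh h dir3 phi)
  else if j == dir2 then gh h dir1 (gh h dir3 phi)
  else gh h dir1 (gh h dir2 phi).

Definition ubar (ell h : R) (N : nat) (G : R -> sfield R) (Delta : R) u
    : vfield R := fun i x =>
  \sum_(j < 3)
    vprojh ell h N i j (volfilter h (convfilter G Delta (u j))) x.

Definition xi (ell nu h : R) (N : nat) (G : R -> sfield R) (Delta : R) u
    : tfield R := fun i j x =>
  surffilter h j (convfilter G Delta (stress ell nu u i j)) x
  - sigmah nu h (ubar ell h N G Delta u) i j x.

(* Regularity in time allowing d/dt to be exchanged with the filters: each
   component has a time derivative that is jointly continuous in (t, x). *)
Definition time_regular (I : set R) (u : R -> vfield R) :=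
  forall (i : 'I_3) t x, I t ->
    derivable (fun r => u r i x) t 1 /\
    {for (t, x), continuous
      (fun z : R * 'rV[R]_3 => derive1 (fun r => u r i z.2) z.1)}.

Definition navier_stokes (ell nu : R) (I : set R) (u : R -> vfield R) :=
  forall t x, I t ->
    \sum_(j < 3) pd j (u t j) x = 0 /\
    forall i : 'I_3,
      derive1 (fun r => u r i x) t
      + \sum_(j < 3) pd j (stress ell nu (u t) i j) x = 0.

End Fields.

(* Main.v *)
Require Import Defs.
From HB Require Import structures.
From mathcomp Require Import all_boot all_order all_algebra.
From mathcomp Require Import all_classical all_reals all_analysis.
From mathcomp Require Import measurable_realfun ring lra.

Import Order.TTheory GRing.Theory Num.Theory.
Import numFieldNormedType.Exports.
Local Open Scope classical_set_scope.
Local Open Scope ring_scope.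

Set Implicit Arguments.
Unset Strict Implicit.
Unset Printing Implicit Defensive.

(** The filters are bounded linear operators on periodic continuous fields that
    commute with translations ([averaging]). Such an operator commutes with every
    derivative whose difference quotients converge uniformly, hence with [d/dt]
    and with the partial derivatives ([averaging_derive_param],
    [pd_averaging]). Averaging a partial derivative over a cube turns it, by
    the fundamental theorem of calculus, into the finite difference of the
    averages over two opposite faces ([volfilter_pd]). Filtering the
    Navier-Stokes equations therefore gives an exact discrete balance: with
    [w_i] the doubly filtered velocity and [S_ij] the face average of the filtered
    stress in direction [j], the time derivative of [w_i] is minus the discrete
    divergence of the row [S_i] ([filtered_momentum]).

    On a periodic grid the discrete inverse Laplacian is the convolution with a
    Green's function ([laplacianh_inv_green]); it is thus linear, commutes with
    finite differences and with [d/dt], and is itself a finite sum. Applying the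
    vector projector to the divergence of [S] subtracts from it the discrete
    gradient of the inverse Laplacian of the double divergence of [S]; the
    divergence of the tensor-projected [S] contains exactly the same pressure term
    ([divh_tprojh_apply]). So the projected velocity evolves by minus the
    divergence of the projected [S], and adding and subtracting the numerical
    stress of the projected velocity under the linear tensor projector gives the
    stated form with the residual [xi]. *)

(** * The periodic grid and its Green's function *)

Section Grid.
Variable R : realType.
Implicit Types (phi psi p : sfield R) (x y : 'rV[R]_3) (h ell : R).

Lemma periodic_int ell phi i (c : int) x : Defs.periodic ell phi ->
  phi (x + (ell * c%:~R) *: unitv R i) = phi x.
Proof.
move=> per; have pos (n : nat) y : phi (y + (ell * n%:R) *: unitv R i) = phi y.
  elim: n y => [|n IH] y; first by rewrite mulr0 scale0r addr0.
  by rewrite mulrSr mulrDr mulr1 scalerDl addrA per IH.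
case: c => n; first exact: pos.
by rewrite NegzE -[LHS](pos n.+1) -addrA -scalerDl rmorphN mulrN addNr scale0r addr0.
Qed.

(** Periodicity along the axes gives invariance under the whole lattice
    [ell Z^3], the form used to wrap grid indices and to move a point into the
    period cell. *)
Lemma periodic_lattice ell phi (c : 'I_3 -> int) x : Defs.periodic ell phi ->
  phi (x + ell *: \row_k (c k)%:~R) = phi x.
Proof.
move=> per; rewrite [\row_k _]row_sum_delta scaler_sumr.
pose P (v : 'rV[R]_3) := forall y, phi (y + v) = phi y.
apply: (_ : P _); apply: (big_ind P).
- by move=> y; rewrite addr0.
- by move=> v w Pv Pw y; rewrite addrA Pw Pv.
- by move=> i _ y; rewrite mxE scalerA periodic_int.
Qed.

Section Modular.
Variable n : nat.
Local Notation grid := {ffun 'I_3 -> 'I_n.+1}.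
Implicit Types m : grid.

(** The index set [{ffun 'I_3 -> 'I_n.+1}] of the grid averages is the group
    [(Z/(n+1))^3]; [grid_vec] sends an index to its representative in [Z^3]. *)
Definition grid_vec m : 'rV[R]_3 := \row_k (m k)%:R.

Definition grid_unit (k : 'I_3) : grid := [ffun i => if i == k then Zp1 else 0].

(** Addition of indices wraps modulo [n + 1], and the carry is a vector of the
    period lattice, so a periodic field cannot see it. *)
Lemma grid_vecD h phi m m' x : Defs.periodic (h * n.+1%:R) phi ->
  phi (x + h *: grid_vec (m + m')) = phi (x + h *: grid_vec m + h *: grid_vec m').
Proof.
move=> per.
rewrite -[LHS](periodic_lattice (fun k => Posz ((m k + m' k) %/ n.+1)%N) _ per).
congr phi; rewrite -!addrA; congr (_ + _).
rewrite -scalerA -!scalerDr; congr (_ *: _); apply/rowP => k; rewrite !mxE ffunE /=.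
by rewrite -natrM -natrD addnC mulnC -divn_eq natrD.
Qed.

Lemma grid_vec_unit h phi k x : Defs.periodic (h * n.+1%:R) phi ->
  phi (x + h *: grid_vec (grid_unit k)) = phi (x + h *: unitv R k).
Proof.
(* [Zp1] has value [1 %% n.+1], so on a grid of one point per direction the
   unit index is [0] and the shift by [h] is the carry. *)
move=> per; pose d i := Posz (if i == k then 1 %/ n.+1 else 0)%N.
rewrite -[LHS](periodic_lattice d _ per).
congr phi; rewrite -!addrA; congr (_ + _).
rewrite -scalerA -!scalerDr; congr (_ *: _); apply/rowP => i; rewrite !mxE ffunE /d.
case: eqP => _ /=; last by rewrite mulr0 addr0.
by rewrite -natrM -natrD addnC mulnC -divn_eq.
Qed.

Lemma grid_sum_unit m : m = \sum_k grid_unit k *+ m k.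
Proof.
apply/ffunP => i; rewrite sum_ffunE (bigD1 i) //= big1 => [|k ki]; last first.
  by rewrite ffunMnE ffunE eq_sym (negPf ki) mul0rn.
rewrite addr0 ffunMnE ffunE eqxx Zp_mulrn; apply/val_inj;
by rewrite /= modnMml mul1n modn_small ?ltn_ord.
Qed.

Lemma grid_sum_shift (f : grid -> R) m' :
  \sum_(m : grid) f (m + m') = \sum_(m : grid) f m.
Proof. by rewrite [RHS](reindex_inj (addIr m')). Qed.

Definition grid_laplacian (f : grid -> R) m : R :=
  \sum_(k < 3) (f (m + grid_unit k) + f (m - grid_unit k) - f m *+ 2).

(** Summation by parts on a finite group: the discrete Dirichlet form. *)
Lemma grid_laplacian_energy (f : grid -> R) :
  \sum_(m : grid) f m * grid_laplacian f m
  = - \sum_(k < 3) \sum_(m : grid) (f (m + grid_unit k) - f m) ^+ 2.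
Proof.
under eq_bigr do rewrite mulr_sumr.
rewrite exchange_big -sumrN; apply: eq_bigr => k _ /=.
pose e := grid_unit k.
transitivity (\sum_(m : grid) (f (m + e) * f m) *+ 2 - \sum_(m : grid) f m ^+ 2 *+ 2).
  rewrite -sumrB.
  transitivity (\sum_(m : grid) (f m * f (m + e) - f m ^+ 2 *+ 2) + \sum_(m : grid) f m * f (m - e)).
    by rewrite -big_split; apply: eq_bigr => m _ /=; ring.
  rewrite -[X in _ + X](grid_sum_shift _ e) -big_split; apply: eq_bigr => m _ /=.
  by rewrite addrK; ring.
rewrite -[RHS]sumrN.
transitivity (\sum_(m : grid) (f (m + e) * f m *+ 2 - f m ^+ 2) - \sum_(m : grid) f m ^+ 2).
  by rewrite -!sumrB; apply: eq_bigr => m _ /=; ring.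
rewrite -[X in _ - X](grid_sum_shift _ e) -sumrB; apply: eq_bigr => m _ /=; rewrite -/e; ring.
Qed.

Lemma grid_laplacian_sum0 (f : grid -> R) : \sum_(m : grid) grid_laplacian f m = 0.
Proof.
rewrite exchange_big big1 // => k _ /=.
rewrite big_split big_split sumrN sumrMnl /=.
by rewrite !grid_sum_shift; ring.
Qed.

(** A harmonic function has zero Dirichlet energy, hence is invariant under each
    unit shift, and these generate the group. *)
Lemma grid_harmonic_const (f : grid -> R) :
  (forall m, grid_laplacian f m = 0) -> forall m, f m = f 0.
Proof.
move=> harm.
have /eqP := grid_laplacian_energy f.
rewrite big1 => [|m _]; last by rewrite harm mulr0.
rewrite eq_sym oppr_eq0 psumr_eq0 => [|k _]; last first.
  by apply: sumr_ge0 => m _; exact: sqr_ge0.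
move=> /allP en; have inv k m : f (m + grid_unit k) = f m.
  have := en k (mem_index_enum k); rewrite /= psumr_eq0 => [|m' _]; last exact: sqr_ge0.
  move=> /allP /(_ m (mem_index_enum m)).
  by rewrite /= sqrf_eq0 subr_eq0 => /eqP.
have invs k j m : f (m + grid_unit k *+ j) = f m.
  elim: j m => [|j IH] m; first by rewrite mulr0n addr0.
  by rewrite mulrS addrA IH inv.
pose P (d : grid) := forall m, f (m + d) = f m.
move=> m; rewrite -[m]add0r (_ : f (0 + m) = f 0) //.
apply: (_ : P m); rewrite [m]grid_sum_unit; apply: (big_ind P).
- by move=> y; rewrite addr0.
- by move=> v w Pv Pw y; rewrite addrA Pw Pv.
- by move=> k _ y; exact: invs.
Qed.

(** The grid Laplacian has the constants as kernel and the zero-mean functions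
    as image. Subtracting the total sum makes it invertible without changing it
    on zero-mean functions. *)
Definition grid_poisson (f : {ffun grid -> R^o}) : {ffun grid -> R^o} :=
  [ffun m => grid_laplacian f m - \sum_(m' : grid) f m'].

Lemma grid_poisson_linear : linear grid_poisson.
Proof.
move=> a f g; apply/ffunP => m; rewrite !ffunE /grid_laplacian.
rewrite scalerBr addrACA -opprD; congr (_ - _).
  rewrite scaler_sumr -big_split; apply: eq_bigr => k _ /=; rewrite !ffunE.
  by rewrite /GRing.scale /=; ring.
by rewrite scaler_sumr -big_split; apply: eq_bigr => k _ /=; rewrite !ffunE.
Qed.

HB.instance Definition _ := GRing.isLinear.Build R {ffun grid -> R^o}
  {ffun grid -> R^o} _ grid_poisson grid_poisson_linear.

(** Green's function of the grid. Since [grid_poisson] is an injective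
    endomorphism of a finite-dimensional space, it reaches the right-hand side
    [delta_0 - 1/(n+1)^3]; both sides having zero total, the solution has zero
    sum, so that the Laplacian itself has this value. *)
Lemma grid_green : exists K : grid -> R,
  forall m, grid_laplacian K m = (m == 0)%:R - (n.+1 ^ 3)%:R^-1.
Proof.
pose c : R := (n.+1 ^ 3)%:R.
have cardG : c = #|{: grid}|%:R by rewrite card_ffun !card_ord.
have c0 : c != 0 by rewrite pnatr_eq0 expn_eq0.
have sumG (a : R) : \sum_(m : grid) a = a * c by rewrite sumr_const cardG mulr_natr.
have : lker (linfun grid_poisson) == 0%VS.
  apply/lker0P => f g; rewrite !lfunE /= => /eqP.
  rewrite -subr_eq0 -raddfB /= => /eqP; move: (f - g) (subr0_eq (x:=f) (y:=g)) => d eqfg d0.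
  apply: eqfg.
  have L m : grid_laplacian d m = \sum_(m' : grid) d m'.
    by move/ffunP: d0 => /(_ m); rewrite !ffunE => /eqP; rewrite subr_eq0 => /eqP.
  have S0 : \sum_(m' : grid) d m' = 0.
    have := grid_laplacian_sum0 d; under eq_bigr do rewrite L.
    by rewrite sumG => /eqP; rewrite mulf_eq0 (negPf c0) orbF => /eqP.
  have C := grid_harmonic_const (fun m => etrans (L m) S0).
  move: S0; under eq_bigr do rewrite C; rewrite sumG => /eqP.
  rewrite mulf_eq0 (negPf c0) orbF => /eqP d00.
  by apply/ffunP => m; rewrite C d00 ffunE.
move/lker0_limgf => lim.
pose b : {ffun grid -> R^o} := [ffun m : grid => ((m == 0)%:R - c^-1 : R^o)].
have /memv_imgP[K _ KE] : b \in limg (linfun grid_poisson) by rewrite lim memvf.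
have {}KE m : grid_laplacian K m = (m == 0)%:R - c^-1 + \sum_(m' : grid) K m'.
  by move/ffunP: KE => /(_ m); rewrite lfunE /= !ffunE => ->; rewrite subrK.
exists K => m; rewrite KE; suff -> : \sum_(m' : grid) K m' = 0 by rewrite addr0.
have := grid_laplacian_sum0 K; under eq_bigr do rewrite KE.
rewrite !big_split /= !sumG (bigD1 (0 : grid)) //= big1 => [|m' /negPf->//].
rewrite mulNr mulVf // eqxx addr0 subrr add0r => /eqP.
by rewrite mulf_eq0 (negPf c0) orbF => /eqP.
Qed.
End Modular.
End Grid.

(** * Finite differences and the discrete inverse Laplacian *)

Section DiscreteOperators.
Variable R : realType.
Implicit Types (phi psi p : sfield R) (x y : 'rV[R]_3) (h ell : R).

Lemma pdhZ h i (c : R) phi : pdh h i (fun x => c * phi x) = fun x => c * pdh h i phi x.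
Proof. by apply/funext => x; rewrite /pdh; ring. Qed.

Lemma pdh_sum h i (J : finType) (F : J -> sfield R) :
  pdh h i (fun x => \sum_j F j x) = fun x => \sum_j pdh h i (F j) x.
Proof. by apply/funext => x; rewrite /pdh -mulr_sumr sumrB. Qed.

Lemma pdhB h i phi psi :
  pdh h i (fun x => phi x - psi x) = fun x => pdh h i phi x - pdh h i psi x.
Proof. by apply/funext => x; rewrite /pdh; ring. Qed.

Lemma pdhN h i phi : pdh h i (fun x => - phi x) = fun x => - pdh h i phi x.
Proof. by apply/funext => x; rewrite /pdh; ring. Qed.

Lemma pdh_periodic h ell i phi :
  Defs.periodic ell phi -> Defs.periodic ell (pdh h i phi).
Proof.
by move=> per j x; rewrite /pdh addrAC per [X in _ - phi X]addrAC per.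
Qed.

Section Green.
Variables (n : nat) (h : R).
Local Notation grid := {ffun 'I_3 -> 'I_n.+1}.
Local Notation L := (h * n.+1%:R).
Implicit Types (K : grid -> R).

(** Convolution over the grid through [x]: a finite combination of translates,
    so it commutes with difference operators and with derivatives in a
    parameter. *)
Definition grid_conv K phi : sfield R :=
  fun x => \sum_(m : grid) K m * phi (x + h *: grid_vec R m).

Lemma grid_conv_sum K (J : finType) (F : J -> sfield R) :
  grid_conv K (fun x => \sum_j F j x) = fun x => \sum_j grid_conv K (F j) x.
Proof.
apply/funext => x; rewrite /grid_conv exchange_big; apply: eq_bigr => m _ /=.
by rewrite mulr_sumr.
Qed.

Lemma grid_convN K phi :
  grid_conv K (fun x => - phi x) = fun x => - grid_conv K phi x.
Proof.
by apply/funext => x; rewrite /grid_conv -sumrN; apply: eq_bigr => m _; ring.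
Qed.

Lemma grid_convB K phi psi :
  grid_conv K (fun x => phi x - psi x) = fun x => grid_conv K phi x - grid_conv K psi x.
Proof.
by apply/funext => x; rewrite /grid_conv -sumrB; apply: eq_bigr => m _; ring.
Qed.

Lemma grid_conv_pdh K i phi : pdh h i (grid_conv K phi) = grid_conv K (pdh h i phi).
Proof.
apply/funext => x; rewrite /pdh /grid_conv -sumrB mulr_sumr.
apply: eq_bigr => m _; rewrite ![x + _ *: unitv R i + _]addrAC.
by rewrite [x - _ *: unitv R i + _]addrAC; ring.
Qed.

Lemma grid_conv_periodic K ell phi :
  Defs.periodic ell phi -> Defs.periodic ell (grid_conv K phi).
Proof. by move=> per i x; apply: eq_bigr => m _; rewrite addrAC per. Qed.

Lemma grid_conv_laplacianh K phi :
  laplacianh h (grid_conv K phi) = grid_conv K (laplacianh h phi).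
Proof.
rewrite grid_conv_sum; apply/funext => x; apply: eq_bigr => k _.
by rewrite !grid_conv_pdh.
Qed.

Lemma laplacianhE phi x : laplacianh h phi x = h ^- 2 *
  \sum_(k < 3) (phi (x + h *: unitv R k) + phi (x - h *: unitv R k) - phi x *+ 2).
Proof.
rewrite /laplacianh mulr_sumr; apply: eq_bigr => k _; rewrite /pdh.
rewrite -!addrA -!opprD -scalerDl addNr subrr addr0 -splitr.
by rewrite -exprVn; ring.
Qed.

(** The Laplacian moves from the field to the kernel, by reindexing the sum over
    the group of indices. *)
Lemma grid_conv_by_parts K phi : Defs.periodic L phi ->
  grid_conv K (laplacianh h phi)
  = fun x => h ^- 2 * \sum_(m : grid) grid_laplacian K m * phi (x + h *: grid_vec R m).
Proof.
move=> per; apply/funext => x; rewrite /grid_conv.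
pose f (m : grid) := phi (x + h *: grid_vec R m).
have fD m k : phi (x + h *: grid_vec R m + h *: unitv R k) = f (m + grid_unit n k).
  by rewrite /f grid_vecD // grid_vec_unit.
have fB m k : phi (x + h *: grid_vec R m - h *: unitv R k) = f (m - grid_unit n k).
  rewrite addrAC -{1}(subrK (grid_unit n k) m) grid_vecD // grid_vec_unit //.
  by rewrite [x - _ + _]addrAC subrK.
transitivity (\sum_(m : grid) \sum_(k < 3)
    h ^- 2 * K m * (f (m + grid_unit n k) + f (m - grid_unit n k) - f m *+ 2)).
  apply: eq_bigr => m _; rewrite laplacianhE !mulr_sumr; apply: eq_bigr => k _.
  by rewrite fD fB -/(f m); ring.
rewrite mulr_sumr; under [RHS]eq_bigr do rewrite mulr_suml mulr_sumr.
rewrite exchange_big [RHS]exchange_big; apply: eq_bigr => k _ /=.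
pose e := grid_unit n k; pose c := h ^- 2.
transitivity (\sum_(m : grid) c * (K m * f (m + e)) + \sum_(m : grid) c * (K m * f (m - e))
   - \sum_(m : grid) c * (K m * f m *+ 2)).
  by rewrite -big_split -sumrB; apply: eq_bigr => m _ /=; rewrite -/e -/c; ring.
rewrite -[X in X + _ - _](grid_sum_shift _ (- e)) -[X in _ + X - _](grid_sum_shift _ e).
rewrite -big_split -sumrB; apply: eq_bigr => m _ /=.
by rewrite subrK addrK -/e -/c -/(f m); ring.
Qed.

(** The two half-step translates in [pdh] differ by a full step, under which the
    average over the grid is invariant. Hence the right-hand side of each
    discrete Poisson problem met below is admissible. *)
Lemma grid_average_pdh i phi x : Defs.periodic L phi ->
  grid_average h n.+1 (pdh h i phi) x = 0.
Proof.
move=> per; rewrite /grid_average /pdh -mulr_sumr sumrB.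
pose y := x - (h / 2) *: unitv R i.
rewrite -(grid_sum_shift (fun m : grid => phi (x + h *: \row_k (m k)%:R - _)) (grid_unit n i)).
rewrite -sumrB big1 ?mulr0 // => m _; apply/eqP; rewrite subr_eq0; apply/eqP.
rewrite [in RHS]addrAC -/(grid_vec R _) grid_vecD // grid_vec_unit //.
congr phi; rewrite addrAC -/(grid_vec R _) [RHS]addrAC; congr (_ + _).
by rewrite -addrA; congr (_ + _); rewrite -scaleNr -scalerDl; congr (_ *: _); lra.
Qed.

(** Convolution with the Green's function inverts the discrete Laplacian from
    both sides on periodic fields of zero grid averages, because the two
    commute. One side gives existence for the discrete Poisson problem, the other
    uniqueness, so the selected solution is this convolution. *)
Lemma laplacianh_inv_green : h != 0 -> exists K : grid -> R, forall phi,
  Defs.periodic L phi -> (forall x, grid_average h n.+1 phi x = 0) ->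
  laplacianh_inv L h n.+1 phi = grid_conv K phi.
Proof.
move=> h0; have [K1 K1E] := grid_green R n.
pose K (m : grid) := h ^+ 2 * K1 m.
have inv psi : Defs.periodic L psi -> (forall x, grid_average h n.+1 psi x = 0) ->
    grid_conv K (laplacianh h psi) = psi.
  move=> per avg; rewrite grid_conv_by_parts //; apply/funext => x.
  have {}KE (m : grid) : grid_laplacian K m = h ^+ 2 * ((m == 0)%:R - (n.+1 ^ 3)%:R^-1).
    rewrite -K1E /grid_laplacian mulr_sumr; apply: eq_bigr => k _.
    by rewrite /K; ring.
  under eq_bigr do rewrite KE -mulrA mulrBl.
  rewrite -mulr_sumr mulKf ?expf_eq0 // sumrB -mulr_sumr.
  rewrite [X in _ - X](avg x) subr0 (bigD1 (0 : grid)) //= big1 => [|m /negPf->].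
    rewrite eqxx mul1r addr0; congr psi.
    rewrite (_ : grid_vec R _ = 0) ?scaler0 ?addr0 //.
    by apply/rowP => i; rewrite !mxE ffunE.
  by rewrite mul0r.
exists K => phi per avg.
have : [set p | [/\ Defs.periodic L p, forall x, laplacianh h p x = phi x
                 & forall x, grid_average h n.+1 p x = 0]] (laplacianh_inv L h n.+1 phi).
  apply: xgetPex; exists (grid_conv K phi); split.
  - exact: grid_conv_periodic.
  - by move=> x; rewrite grid_conv_laplacianh inv.
  - move=> x; rewrite /grid_average exchange_big mulr_sumr big1 // => m _ /=.
    rewrite -mulr_sumr; under eq_bigr do rewrite addrAC.
    by have := avg (x + h *: grid_vec R m); rewrite /grid_average mulrCA => ->; rewrite mulr0.
by move=> [perp /funext lapp avgp]; rewrite -[in RHS]lapp inv.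
Qed.

End Green.
End DiscreteOperators.

(** * Uniform estimates on the torus *)

Section Torus.
Variables (R : realType) (ell : R).
Hypothesis ell_gt0 : 0 < ell.
Implicit Types (phi psi : sfield R) (x y : 'rV[R]_3).

Definition cell : set 'rV[R]_3 := [set y | forall i, `[0, ell]%classic (y ord0 i)].

Lemma cell_compact : compact cell.
Proof. by apply: (@rV_compact _ _ (fun=> `[0, ell]%classic)) => i; exact: segment_compact. Qed.

Lemma cell_representative x : exists2 c : 'I_3 -> int,
  cell (x + ell *: \row_k (c k)%:~R) &
  forall phi, Defs.periodic ell phi -> phi (x + ell *: \row_k (c k)%:~R) = phi x.
Proof.
pose c k := - Num.floor (x ord0 k / ell).
exists c => [i /=|phi]; last exact: periodic_lattice.
have /andP[] := floor_itv (x ord0 i / ell).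
rewrite !mxE in_itv /= /c rmorphN mulrN rmorphD /= ler_pdivlMr // ltr_pdivrMr //.
by move=> le lt; apply/andP; split; lra.
Qed.

(** Compactness of the period cell turns local estimates at its points into an
    estimate uniform over all of [R^3]. *)
Lemma near_uniform_torus (J : Type) (F : set_system J) (Psi : J -> sfield R)
    phi (e : R) : Filter F ->
  (\forall j \near F, Defs.periodic ell (Psi j)) -> Defs.periodic ell phi ->
  (forall x, \forall y \near x & j \near F, `|Psi j y - phi y| < e) ->
  \forall j \near F, forall x, `|Psi j x - phi x| < e.
Proof.
move=> FF perF per loc.
have cptK := cell_compact.
have cov := (iffLR (compact_near_coveringP _)) cptK J F
  (fun j y => `|Psi j y - phi y| < e) FF (fun x _ => loc x).
near=> j; move=> x; have [c Kc cE] := cell_representative x.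
have perj : Defs.periodic ell (Psi j) by near: j; exact: perF.
rewrite -(cE _ per) -(cE _ perj).
by move: {+}(x + _) Kc; near: j; exact: cov.
Unshelve. all: by end_near. Qed.

Lemma near_uniform_param (J : topologicalType) (t : J) (Psi : J -> sfield R) (e : R) :
  0 < e -> (\forall j \near t, Defs.periodic ell (Psi j)) ->
  (forall x, {for (t, x), continuous (fun z : J * 'rV[R]_3 => Psi z.1 z.2)}) ->
  \forall j \near t, forall x, `|Psi j x - Psi t x| < e.
Proof.
move=> e0 per cPsi; apply: near_uniform_torus => //; first exact: nbhs_singleton per.
move=> x; have e20 : 0 < e / 2 by rewrite divr_gt0.
have /cvgr_dist_lt /(_ _ e20) [[A B] /= [At Bx] AB] := cPsi x.
exists (B, A) => //= -[y j] [/= By Aj].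
have := AB (j, y) (conj Aj By); have := AB (t, y) (conj (nbhs_singleton At) By).
rewrite /= -(opprB (Psi t y) (Psi j y)) normrN.
rewrite (_ : Psi t y - _ = (Psi t x - Psi j y) - (Psi t x - Psi t y)); last by ring.
move=> h1 h2; apply: le_lt_trans (ler_normB _ _) _.
by rewrite (splitr e); exact: ltrD.
Qed.

(** The Banach space on which the filters act, with the sup norm. *)
Definition cont_periodic phi := Defs.periodic ell phi /\ continuous phi.

Lemma cont_periodic_bounded phi : cont_periodic phi ->
  exists M, forall x, `|phi x| <= M.
Proof.
move=> [per cphi].
have cptK := cell_compact.
have [M [_ Mb]] := compact_bounded
  (continuous_compact (continuous_subspaceT cphi) cptK).
exists (M + 1) => x; have [c Kc cE] := cell_representative x.
by rewrite -(cE _ per); apply: (Mb (M + 1)); [rewrite ltrDl|exists (x + ell *: \row_k (c k)%:~R)].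
Qed.

(** Periodic continuous fields are uniformly continuous; equivalently,
    translation acts continuously on them for the sup norm. *)
Lemma near_uniform_shift phi (e : R) : cont_periodic phi -> 0 < e ->
  \forall z \near (0 : 'rV[R]_3), forall x, `|phi (x + z) - phi x| < e.
Proof.
move=> [per cphi] e0.
have n : \forall z \near (0 : 'rV[R]_3), forall x, `|phi (x + z) - phi (x + 0)| < e.
  apply: (@near_uniform_param _ (0 : 'rV[R]_3) (fun z x => phi (x + z)) e e0) => //.
    by near=> z => i x; rewrite addrAC per.
  move=> x; apply: (@continuous_comp _ _ _ (fun z : 'rV[R]_3 * 'rV[R]_3 => z.2 + z.1) phi); last exact: cphi.
  by apply: cvgD; [exact: cvg_snd|exact: cvg_fst].
by near=> z => x; rewrite -[X in _ - phi X]addr0; move: x; near: z.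
Unshelve. all: by end_near. Qed.
End Torus.

(** * Translation-invariant bounded operators *)

Section Averaging.
Variables (R : realType) (ell : R).
Hypothesis ell_gt0 : 0 < ell.
Local Notation cont_periodic := (@cont_periodic R ell).
Implicit Types (phi psi : sfield R) (x y : 'rV[R]_3) (T : sfield R -> sfield R).

Lemma cont_periodic_lin (a : R) phi psi : cont_periodic phi -> cont_periodic psi ->
  cont_periodic (fun x => a * phi x + psi x).
Proof.
move=> [p1 c1] [p2 c2]; split; first by move=> i x; rewrite p1 p2.
by move=> x; exact: cvgD (cvgM (cvg_cst a) (c1 x)) (c2 x).
Qed.

Lemma cont_periodic0 : cont_periodic (fun=> 0).
Proof. by split; [move=> i x|exact: cst_continuous]. Qed.

Lemma cont_periodicN phi : cont_periodic phi -> cont_periodic (fun x => - phi x).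
Proof.
move=> cp; rewrite (_ : (fun x => _) = fun x => -1 * phi x + 0).
  by apply: cont_periodic_lin => //; exact: cont_periodic0.
by apply/funext => x; ring.
Qed.

Lemma cont_periodic_sum (J : finType) (F : J -> sfield R) :
  (forall j, cont_periodic (F j)) -> cont_periodic (fun x => \sum_j F j x).
Proof.
move=> cp; pose P (phi : sfield R) := cont_periodic phi.
rewrite (_ : (fun x => _) = \sum_j F j); last first.
  by apply/funext => x; rewrite fct_sumE.
apply: (big_ind P) => [|f g Pf Pg|j _]; [exact: cont_periodic0| |exact: cp].
rewrite /P (_ : f + g = fun x => 1 * f x + g x); first exact: cont_periodic_lin.
by apply/funext => x; rewrite mul1r.
Qed.

Lemma cont_periodic_shift phi y : cont_periodic phi ->
  cont_periodic (fun x => phi (x + y)).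
Proof.
move=> [p c]; split; first by move=> i x; rewrite addrAC p.
move=> x; apply: (@continuous_comp _ _ _ (fun x => x + y) phi); last exact: c.
exact: cvgD (cvg_id) (cvg_cst y).
Qed.

(** The three properties of a filter that the argument uses: it is a bounded
    linear operator on periodic continuous fields, commuting with translations.
    They are stable under composition. *)
Record averaging T : Prop := Averaging {
  averaging_lin : forall (a : R) phi psi, cont_periodic phi -> cont_periodic psi ->
    T (fun x => a * phi x + psi x) = fun x => a * T phi x + T psi x;
  averaging_shift : forall phi y, cont_periodic phi ->
    T (fun x => phi (x + y)) = fun x => T phi (x + y);
  averaging_bounded : exists2 C : R, 0 < C & forall phi M, cont_periodic phi ->
    (forall x, `|phi x| <= M) -> forall x, `|T phi x| <= C * M }.

Section Theory.
Variable T : sfield R -> sfield R.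
Hypothesis avgT : averaging T.

Lemma averaging0 : T (fun=> 0) = fun=> 0.
Proof.
have := averaging_lin avgT 1 cont_periodic0 cont_periodic0.
rewrite (_ : (fun x => _) = fun=> 0); last by apply/funext => x; ring.
by move=> /funeqP E; apply/funext => x; have := E x; lra.
Qed.

Lemma averagingN phi : cont_periodic phi ->
  T (fun x => - phi x) = fun x => - T phi x.
Proof.
move=> cp; have := averaging_lin avgT (-1) cp cont_periodic0.
rewrite averaging0 => E.
transitivity (T (fun x => -1 * phi x + 0)); first by congr T; apply/funext => x; ring.
by rewrite E; apply/funext => x; ring.
Qed.

Lemma averaging_sum (J : finType) (F : J -> sfield R) :
  (forall j, cont_periodic (F j)) ->
  T (fun x => \sum_j F j x) = fun x => \sum_j T (F j) x.
Proof.
move=> cp.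
pose P (phi psi : sfield R) := cont_periodic phi /\ T phi = psi.
suff [] : P (\sum_j F j) (\sum_j T (F j)).
  rewrite (_ : \sum_j F j = fun x => \sum_j F j x) => [_ ->|].
    by apply/funext => x; rewrite fct_sumE.
  by apply/funext => x; rewrite fct_sumE.
apply: (big_ind2 P) => [|f f' g g' [cf <-] [cg <-]|j _]; last by split.
  by split; [exact: cont_periodic0|exact: averaging0].
rewrite /P (_ : f + g = fun x => 1 * f x + g x); last by apply/funext => x; rewrite mul1r.
split; first exact: cont_periodic_lin.
by rewrite averaging_lin //; apply/funext => x; rewrite mul1r.
Qed.

(** Translations are continuous for the sup norm and commute with [T], whence the
    continuity of [T phi]. *)
Lemma averaging_cont_periodic phi : cont_periodic phi -> cont_periodic (T phi).
Proof.
move=> cp; have [C C0 bT] := averaging_bounded avgT; split.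
  move=> i x; have /funeqP <- := averaging_shift avgT (ell *: unitv R i) cp.
  by congr (T _ _); apply/funext => y; case: cp.
move=> x; suff: T phi y @[y --> x] --> T phi x by [].
apply/(cvgrPdist_le (FF := nbhs_filter x)) => e e0.
have e'0 : 0 < e / C by rewrite divr_gt0.
have sub0 : (fun y => y - x) @ x --> (0 : 'rV[R]_3).
  rewrite -[X in _ --> X](subrr x); exact: cvgB cvg_id (cvg_cst x).
have n := sub0 _ (near_uniform_shift ell_gt0 cp e'0).
near=> y.
have ny : forall z, `|phi (z + (y - x)) - phi z| < e / C by near: y; exact: n.
have -> : T phi x - T phi y = - T (fun z => -1 * phi z + phi (z + (y - x))) x.
  rewrite averaging_lin //; last exact: cont_periodic_shift.
  rewrite averaging_shift // (_ : x + (y - x) = y); last by rewrite addrC subrK.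
  by ring.
rewrite normrN -[leRHS](@divfK _ C) ?gt_eqF // mulrC; apply: bT.
  by apply: cont_periodic_lin => //; exact: cont_periodic_shift.
by move=> z; rewrite mulN1r addrC ltW.
Unshelve. all: by end_near. Qed.

(** A bounded operator preserves uniform limits, in particular the limit of a
    uniformly convergent difference quotient. *)
Lemma averaging_is_derive (Phi : R -> sfield R) psi (t : R) x :
  (\forall s \near t, cont_periodic (Phi s)) -> cont_periodic psi ->
  (forall e, 0 < e ->
     \forall d \near 0^', forall y, `|d^-1 * (Phi (d + t) y - Phi t y) - psi y| <= e) ->
  is_derive t 1 (fun s => T (Phi s) x) (T psi x).
Proof.
move=> cPhi cpsi quot; have [C C0 bT] := averaging_bounded avgT.
have cPhit := nbhs_singleton cPhi.
suff c : (fun d => d^-1 *: (T (Phi (d *: 1 + t)) x - T (Phi t) x)) @ 0^' --> T psi x.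
  by apply: DeriveDef; [apply: cvgP c|exact: cvg_lim c].
apply/cvgrPdist_le => e e0.
have e'0 : 0 < e / C by rewrite divr_gt0.
have n1 : \forall d \near 0^', cont_periodic (Phi (d + t)).
  have addt : (fun d : R => d + t) @ 0^' --> 0 + t.
    by apply: cvg_within_filter; exact: cvgD cvg_id (cvg_cst t).
  by apply: (addt (fun s => cont_periodic (Phi s))); rewrite add0r.
have n2 := quot _ e'0.
near=> d.
have cPhid : cont_periodic (Phi (d + t)) by near: d; exact: n1.
have nd : forall y, `|d^-1 * (Phi (d + t) y - Phi t y) - psi y| <= e / C.
  by near: d; exact: n2.
rewrite [d *: 1]mulr1.
have -> : T psi x - d^-1 *: (T (Phi (d + t)) x - T (Phi t) x) = - T
    (fun y => d^-1 * Phi (d + t) y + (- d^-1 * Phi t y + (-1 * psi y + 0))) x.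
  have c0 := cont_periodic0; have c1 := cont_periodic_lin (-1) cpsi c0.
  have c2 := cont_periodic_lin (- d^-1) cPhit c1.
  by rewrite !averaging_lin // averaging0 /GRing.scale /=; ring.
rewrite normrN -[leRHS](@divfK _ C) ?gt_eqF // mulrC; apply: bT.
  by do 3! (apply: cont_periodic_lin => //); exact: cont_periodic0.
by move=> y; apply: le_trans (nd y); rewrite le_eqVlt; apply/predU1l; congr `|_|; ring.
Unshelve. all: by end_near. Qed.

End Theory.

Lemma averaging_id : averaging id.
Proof. by split=> //; exists 1 => // phi M _ b x; rewrite mul1r. Qed.

Lemma averaging_comp T T' : averaging T -> averaging T' -> averaging (T \o T').
Proof.
move=> aT aT'; split.
- move=> a phi psi c1 c2 /=.
  by rewrite (averaging_lin aT') // (averaging_lin aT) //; exact: averaging_cont_periodic.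
- move=> phi y c /=.
  by rewrite (averaging_shift aT') // (averaging_shift aT) //; exact: averaging_cont_periodic.
- have [C C0 b] := averaging_bounded aT; have [C' C'0 b'] := averaging_bounded aT'.
  exists (C * C'); first exact: mulr_gt0.
  move=> phi M cp bM x; rewrite -mulrA; apply: b; first exact: averaging_cont_periodic.
  by move=> y; exact: b'.
Qed.

End Averaging.

(** * Differentiation under an averaging operator *)

Section Differentiation.
Variables (R : realType) (ell : R).
Hypothesis ell_gt0 : 0 < ell.
Local Notation cont_periodic := (@cont_periodic R ell).
Local Notation averaging := (@averaging R ell).
Implicit Types (phi psi : sfield R) (x y : 'rV[R]_3) (T : sfield R -> sfield R).

Lemma mean_value_increment (f df : R -> R) (t r d : R) :
  (forall s, `|s - t| < r -> is_derive s 1 f (df s)) -> `|d| < r ->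
  exists2 c, `|c - t| < r & f (d + t) - f t = df c * d.
Proof.
move=> fdf dr.
have cf (a b : R) : `|a - t| < r -> `|b - t| < r -> {within `[a, b], continuous f}.
  move=> ar br; apply: derivable_within_continuous => s; rewrite in_itv /= => /andP[a_s sb].
  have sr : `|s - t| < r by move: ar br; rewrite !ltr_norml => /andP[? ?] /andP[? ?]; lra.
  by case: (fdf _ sr).
have [d0|/ltW d0] := leP 0 d.
- have [| | |c] := @MVT_segment _ f df t (d + t).
  + by rewrite lerDr.
  + move=> s; rewrite in_itv /= => /andP[ts sd]; apply: fdf.
    by move: dr; rewrite !ltr_norml => /andP[? ?]; lra.
  + by apply: cf; rewrite ?subrr ?normr0 ?addrK // (le_lt_trans _ dr).
  rewrite in_itv /= => /andP[tc cd] ->; exists c; last by rewrite addrK.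
  by move: dr; rewrite !ltr_norml => /andP[? ?]; lra.
- have [| | |c] := @MVT_segment _ f df (d + t) t.
  + by rewrite gerDr.
  + move=> s; rewrite in_itv /= => /andP[ts sd]; apply: fdf.
    by move: dr; rewrite !ltr_norml => /andP[? ?]; lra.
  + by apply: cf; rewrite ?subrr ?normr0 ?addrK // (le_lt_trans _ dr).
  rewrite in_itv /= => /andP[tc cd] E; exists c.
    by move: dr; rewrite !ltr_norml => /andP[? ?]; lra.
  by rewrite -opprB E; ring.
Qed.

(** The mean value theorem writes the difference quotient as a value of [Psi] at
    an intermediate parameter, which is uniformly close to [Psi t]. *)
Lemma near_uniform_quotient (Phi Psi : R -> sfield R) (t e : R) : 0 < e ->
  (\forall s \near t, forall x, is_derive (s : R) 1 (fun r => Phi r x) (Psi s x)) ->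
  (\forall s \near t, Defs.periodic ell (Psi s)) ->
  (forall x, {for (t, x), continuous (fun z : R * 'rV[R]_3 => Psi z.1 z.2)}) ->
  \forall d \near 0^', forall x, `|d^-1 * (Phi (d + t) x - Phi t x) - Psi t x| <= e.
Proof.
move=> e0 dPhi per cPsi.
have [r /= r0 rP] := iffLR (nbhs_ballP _ _) (filterI dPhi (near_uniform_param ell_gt0 e0 per cPsi)).
have {}rP s : `|s - t| < r -> (forall x, is_derive (s : R) 1 (fun r => Phi r x) (Psi s x)) /\
    (forall x, `|Psi s x - Psi t x| < e).
  by move=> sr; apply: rP; rewrite /ball /= distrC.
near=> d; move=> x.
have d0 : d != 0 by near: d; exact: nbhs_dnbhs_neq.
have dr : `|d| < r by near: d; apply: dnbhs0_lt.
have [c cr ->] := @mean_value_increment (fun s => Phi s x) (fun s => Psi s x) t r d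
  (fun s sr => (rP s sr).1 x) dr.
by rewrite mulrC mulfK // ltW //; exact: (rP c cr).2.
Unshelve. all: by end_near. Qed.

(** Differentiation under the filter. It serves twice: with the time as
    parameter, and with translation along an axis as parameter, which yields the
    commutation with the partial derivatives. *)
Lemma averaging_derive_param T (Phi Psi : R -> sfield R) (t : R) x : averaging T ->
  (\forall s \near t, cont_periodic (Phi s)) -> cont_periodic (Psi t) ->
  (\forall s \near t, forall x, is_derive (s : R) 1 (fun r => Phi r x) (Psi s x)) ->
  (\forall s \near t, Defs.periodic ell (Psi s)) ->
  (forall x, {for (t, x), continuous (fun z : R * 'rV[R]_3 => Psi z.1 z.2)}) ->
  is_derive t 1 (fun s => T (Phi s) x) (T (Psi t) x).
Proof.
move=> aT cPhi cPsit dPhi perPsi cPsi; apply: (@averaging_is_derive _ ell T aT Phi (Psi t) t x) => // e e0.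
exact: near_uniform_quotient.
Qed.

Definition C1_periodic phi := cont_periodic phi /\
  forall k, (forall x, derivable phi x (unitv R k)) /\ cont_periodic (pd k phi).

Lemma line_quotient phi x v (s : R) :
  (fun d => d^-1 *: (phi (x + (d *: 1 + s) *: v) - phi (x + s *: v)))
  = (fun d => d^-1 *: (phi (d *: v + (x + s *: v)) - phi (x + s *: v))).
Proof.
apply/funext => d; congr (_ *: (phi _ - _)).
by rewrite [d *: 1]mulr1 scalerDl addrCA.
Qed.

Lemma is_derive_line phi x v (s df : R) :
  is_derive s 1 (fun r => phi (x + r *: v)) df <-> is_derive (x + s *: v) v phi df.
Proof.
split=> -[d <-]; apply: DeriveDef.
- by move: d; rewrite /derivable line_quotient.
- by rewrite /derive line_quotient.
- by move: d; rewrite /derivable line_quotient.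
- by rewrite /derive line_quotient.
Qed.

(** The derivative of [T phi] along an axis is the derivative at [s = 0] of [T]
    applied to the translate of [phi] by [s]. *)
Lemma averaging_pd T phi k x : averaging T -> C1_periodic phi ->
  is_derive x (unitv R k) (T phi) (T (pd k phi) x).
Proof.
move=> aT [cp /(_ k)[dphi cpk]].
pose Phi s : sfield R := fun y => phi (y + s *: unitv R k).
pose Psi s : sfield R := fun y => pd k phi (y + s *: unitv R k).
have TE f : cont_periodic f -> T (fun y => f (y + 0 *: unitv R k)) x = T f x.
  by move=> cf; congr (T _ _); apply/funext => y; rewrite scale0r addr0.
have : is_derive (0 : R) 1 (fun s => T (Phi s) x) (T (Psi 0) x).
  apply: averaging_derive_param => //.
  - by near=> s; exact: cont_periodic_shift.
  - exact: cont_periodic_shift.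
  - near=> s => y; apply/is_derive_line.
    by apply: DeriveDef => //; exact: dphi.
  - by near=> s; case: (cont_periodic_shift (s *: unitv R k) cpk).
  - move=> y; apply: (@continuous_comp _ _ _
      (fun z : R * 'rV[R]_3 => z.2 + z.1 *: unitv R k) (pd k phi)); last exact: cpk.2.
    apply: cvgD; first exact: cvg_snd.
    by apply: cvgZ; [exact: cvg_fst|exact: cvg_cst].
rewrite /Psi TE //.
rewrite (_ : (fun s => T (Phi s) x) = fun s => T phi (x + s *: unitv R k)).
  by move/is_derive_line; rewrite scale0r addr0.
by apply/funext => s; rewrite /Phi (averaging_shift aT).
Unshelve. all: by end_near. Qed.

Lemma averaging_C1 T phi : averaging T -> C1_periodic phi -> C1_periodic (T phi).
Proof.
move=> aT c1; have [cp c] := c1; split; first exact: averaging_cont_periodic.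
move=> k; split=> [x|]; first by case: (averaging_pd k x aT c1).
rewrite (_ : pd k (T phi) = T (pd k phi)).
  by apply: averaging_cont_periodic => //; case: (c k).
by apply/funext => x; exact/derive_val/averaging_pd.
Qed.

Lemma pd_averaging T phi k : averaging T -> C1_periodic phi ->
  pd k (T phi) = T (pd k phi).
Proof. by move=> aT c1; apply/funext => x; exact: (@derive_val _ _ _ _ _ _ _ (averaging_pd k x aT c1)). Qed.

End Differentiation.

(** * Box and face averages *)

Section BoxFilters.
Variables (R : realType) (ell h : R).
Hypotheses (ell_gt0 : 0 < ell) (h_gt0 : 0 < h).
Local Notation cont_periodic := (@cont_periodic R ell).
Local Notation averaging := (@averaging R ell).
Local Notation C1_periodic := (@C1_periodic R ell).
Local Notation mu := (@lebesgue_measure R).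
Implicit Types (phi psi : sfield R) (x y : 'rV[R]_3) (T : sfield R -> sfield R).

Lemma continuous_line phi x v : continuous phi ->
  continuous (fun a : R => phi (x + a *: v)).
Proof.
move=> c a; apply: (@continuous_comp _ _ _ (fun a : R => x + a *: v) phi); last exact: c.
by apply: cvgD; [exact: cvg_cst|apply: cvgZ; [exact: cvg_id|exact: cvg_cst]].
Qed.

Lemma integrable_line phi x v : continuous phi ->
  mu.-integrable `[- (h / 2), h / 2] (EFin \o (fun a : R => phi (x + a *: v))).
Proof.
move=> c; apply: continuous_compact_integrable; first exact: segment_compact.
exact/continuous_subspaceT/continuous_line.
Qed.

Lemma gh_averaging i : averaging (gh h i).
Proof.
have h0 : h != 0 by rewrite gt_eqF.
split.
- move=> a phi psi [_ c1] [_ c2]; apply/funext => x; rewrite /gh.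
  have i1 := integrable_line x (unitv R i) c1.
  have i2 := integrable_line x (unitv R i) c2.
  rewrite RintegralD //; first by rewrite RintegralZl //; ring.
  exact: (integrableZl _ a i1).
- move=> phi y cp; apply/funext => x; congr (_ * _); apply: eq_Rintegral => a _.
  by rewrite addrAC.
- exists 1 => // phi M [_ c] bM x; rewrite mul1r /gh normrM.
  have i1 := integrable_line x (unitv R i) c.
  rewrite gtr0_norm ?invr_gt0 // ler_pdivrMl //.
  apply: le_trans (le_normr_Rintegral _ i1) _ => //.
  apply: le_trans (_ : \int[mu]_(a in `[- (h / 2), h / 2]) M <= _).
    apply: le_Rintegral => //; first exact: integrable_norm.
    apply: continuous_compact_integrable; first exact: segment_compact.
    exact/continuous_subspaceT/cst_continuous.
  have hh : - (h / 2) < h / 2 by move: h_gt0; lra.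
  rewrite Rintegral_cst //= lebesgue_measure_itv /= lte_fin hh.
  by rewrite /= mulrC; apply: ler_wpM2r; [apply: le_trans (bM x); exact: normr_ge0|move: h_gt0; lra].
Qed.

(** The fundamental theorem of calculus: the mean of a derivative over a segment
    of length [h] is the difference quotient at its endpoints. *)
Lemma gh_pd k phi : C1_periodic phi -> gh h k (pd k phi) = pdh h k phi.
Proof.
move=> [[_ c] /(_ k)[d [_ ck]]]; apply/funext => x; rewrite /gh /pdh; congr (_ * _).
pose F (a : R) := phi (x + a *: unitv R k).
have dF (a : R) : is_derive a 1 F (pd k phi (x + a *: unitv R k)).
  by apply/is_derive_line; apply: DeriveDef.
have cF : continuous F by exact: continuous_line.
rewrite /Rintegral (@continuous_FTC2 _ _ F) /=.
- by rewrite /F scaleNr.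
- by move: h_gt0; lra.
- exact/continuous_subspaceT/continuous_line.
- split.
  + by move=> a _; case: (dF a).
  + by apply: cvg_at_right_filter; exact: cF.
  + by apply: cvg_at_left_filter; exact: cF.
- by move=> a _; rewrite derive1E; have [_ ->] := dF a.
Qed.

Lemma averaging_pdh T i phi : averaging T -> cont_periodic phi ->
  T (pdh h i phi) = pdh h i (T phi).
Proof.
move=> aT cp; pose v := (h / 2) *: unitv R i.
have cs y := cont_periodic_shift y cp.
have c0 := cont_periodic0 ell.
have E : pdh h i phi = fun x => h^-1 * phi (x + v) + (- h^-1 * phi (x + - v) + 0).
  by apply/funext => x; rewrite /pdh; ring.
rewrite E !(averaging_lin aT) //; last exact: cont_periodic_lin.
rewrite !(averaging_shift aT) // (averaging0 aT).
by apply/funext => x; rewrite /pdh; ring.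
Qed.

Lemma volfilter_averaging : averaging (volfilter h).
Proof.
have g := gh_averaging.
exact: (averaging_comp ell_gt0 (g dir1) (averaging_comp ell_gt0 (g dir2) (g dir3))).
Qed.

Lemma surffilter_averaging j : averaging (surffilter h j).
Proof.
have g := gh_averaging; have c i k := averaging_comp ell_gt0 (g i) (g k).
rewrite /surffilter; case: eqP => _; first exact: (c dir2 dir3).
by case: eqP => _; [exact: (c dir1 dir3)|exact: (c dir1 dir2)].
Qed.

(** Discrete divergence theorem for one component. The derivative moves
    outwards past the averages applied before the one in its own direction,
    which turns it into a finite difference; this difference moves past the
    remaining averages. The averages themselves are never exchanged. *)
Lemma volfilter_pd k phi : C1_periodic phi ->
  volfilter h (pd k phi) = pdh h k (surffilter h k phi).
Proof.
move=> c1; have g := gh_averaging; have cp := c1.1.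
have gc i := averaging_cont_periodic ell_gt0 (g i).
have gC1 i f (cf : C1_periodic f) : C1_periodic (gh h i f) :=
  averaging_C1 ell_gt0 (g i) cf.
rewrite /volfilter /surffilter.
case: eqP => [->|/eqP k1].
  rewrite -(pd_averaging ell_gt0 dir1 (g dir3) c1).
  rewrite -(pd_averaging ell_gt0 dir1 (g dir2) (gC1 _ _ c1)).
  exact: gh_pd _ (gC1 _ _ (gC1 _ _ c1)).
case: eqP => [->|/eqP k2].
  rewrite -(pd_averaging ell_gt0 dir2 (g dir3) c1) (gh_pd _ (gC1 _ _ c1)).
  exact: averaging_pdh _ (g dir1) (gc _ _ cp).
have -> : k = dir3.
  by apply/val_inj; move: k1 k2; case: k => -[|[|[|//]]] //= i; rewrite -val_eqE.
rewrite (gh_pd _ c1) (averaging_pdh dir3 (g dir2) cp).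
exact: averaging_pdh _ (g dir1) (gc _ _ cp).
Qed.

End BoxFilters.

(** * Convolution filters *)

Section ProductMap.
Context d1 d2 (T1 : measurableType d1) (T2 : measurableType d2) (R : realType).
Variables (m1 : {measure set T1 -> \bar R})
          (m2 : {sigma_finite_measure set T2 -> \bar R}).

Definition map_pair (f1 : T1 -> T1) (f2 : T2 -> T2) (y : T1 * T2) : T1 * T2 :=
  (f1 y.1, f2 y.2).

Variables (f1 : T1 -> T1) (f2 : T2 -> T2).
Hypotheses (mf1 : measurable_fun setT f1) (mf2 : measurable_fun setT f2).

Lemma measurable_map_pair : measurable_fun setT (map_pair f1 f2).
Proof.
apply: measurable_fun_pair.
- exact: measurableT_comp mf1 measurable_fst.
- exact: measurableT_comp mf2 measurable_snd.
Qed.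

Hypotheses (pf1 : forall A, measurable A -> m1 (f1 @^-1` A) = m1 A)
           (pf2 : forall A, measurable A -> m2 (f2 @^-1` A) = m2 A).

(** The product measure integrates the measures of slices, and the slice at [x]
    of a preimage is the preimage by [f2] of the slice at [f1 x]. *)
Lemma product_measure_map_pair A : measurable A ->
  (m1 \x m2)%E (map_pair f1 f2 @^-1` A) = (m1 \x m2)%E A.
Proof.
move=> mA; rewrite /product_measure1.
have mA2 : measurable_fun setT (m2 \o xsection A) by exact: measurable_fun_xsection.
transitivity (\int[m1]_x (m2 \o xsection A) (f1 x))%E.
  apply: eq_integral => x _ /=; rewrite -[RHS]pf2; last exact: measurable_xsection.
  by congr (m2 _); apply/seteqP; split => y; rewrite /= /xsection /= !inE.
have := @ge0_integral_pushforward _ _ _ _ _ _ mf1 m1 setT (m2 \o xsection A).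
rewrite preimage_setT => <- //.
pose m := measure_function_pushforward__canonical__measure_function_Measure m1 mf1.
by apply: (@eq_measure_integral _ _ _ _ m1 m) => B mB _; exact: pf1.
Qed.
End ProductMap.

Section Convolution.
Variable R : realType.
Local Notation leb := (@lebesgue_measure R).
Local Notation R2 := (measurableTypeR R * measurableTypeR R)%type.
Local Notation RR := ((measurableTypeR R * measurableTypeR R) * measurableTypeR R)%type.
Local Notation mu := ((leb \x leb) \x leb)%E.
Implicit Types (phi psi : sfield R) (x : 'rV[R]_3) (y : RR).

(** The product sigma-algebra contains the preimages of open sets, as each of
    them is a countable union of rational cubes. *)
Lemma measurable_pt3_preimage (O : set 'rV[R]_3) : open O ->
  measurable [set y : RR | O (pt3 y)].
Proof.
move=> oO; pose S := [set y : RR | O (pt3 y)].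
pose cube (qk : (rat * rat * rat) * nat) : set RR :=
  (ball (ratr qk.1.1.1 : R) qk.2.+1%:R^-1 `*` ball (ratr qk.1.1.2 : R) qk.2.+1%:R^-1)
  `*` ball (ratr qk.1.2 : R) qk.2.+1%:R^-1.
rewrite (_ : [set y | _] = \bigcup_qk (if `[< cube qk `<=` S >] then cube qk else set0)).
  apply: countable_bigcupT_measurable => // qk; case: ifP => _; last exact: measurable0.
  by apply: measurableX; [apply: measurableX|]; rewrite ball_itv; exact: measurable_itv.
apply/seteqP; split => [y Oy|y [qk _]]; last first.
  by case: ifPn => [/asboolP sub /sub|].
have /nbhs_ballP[r /= r0 rO] := open_nbhs_nbhs (conj oO Oy).
(* A cube of half-width [1/(k+1)] containing [y] lies within [2/(k+1)] of it. *)
have [k kr] : exists k : nat, 2 / k.+1%:R < r.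
  exists (Num.truncn (2 / r)).
  by rewrite ltr_pdivrMr // mulrC -ltr_pdivrMr // truncnS_gt.
pose e : R := k.+1%:R^-1; have e0 : 0 < e by rewrite invr_gt0.
have rat_near (a : R) : exists q : rat, `|ratr q - a| < e.
  have [q] := @rat_in_itvoo R (a - e) (a + e) ltac:(lra).
  by rewrite in_itv /= => /andP[? ?]; exists q; rewrite ltr_norml; lra.
have [q1 q1P] := rat_near y.1.1; have [q2 q2P] := rat_near y.1.2.
have [q3 q3P] := rat_near y.2.
exists ((q1, q2, q3), k) => //; rewrite ifT; first by split; [split|].
apply/asboolP => z [[/= z1 z2] z3]; apply: rO.
have tri (q a b : R) : `|q - a| < e -> ball q e b -> ball a r b.
  rewrite /ball /= => qa qb; apply: lt_trans kr.
  rewrite (_ : a - b = (q - b) - (q - a)); last by ring.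
  by apply: le_lt_trans (ler_normB _ _) _; rewrite mulr_natl mulr2n ltrD.
split=> [|i j]; first exact: r0.
rewrite !mxE; case: j => -[|[|[|//]]] /= _.
- exact: tri q1P z1.
- exact: tri q2P z2.
- exact: tri q3P z3.
Qed.

Lemma measurable_pt3 phi : continuous phi ->
  measurable_fun [set: RR] (fun y => phi (pt3 y)).
Proof.
move=> /continuousP cphi; apply: (measurability _ (RGenOpens.measurableE R)).
move=> _ [_ [a [b ->] <-]]; rewrite setTI.
exact: (measurable_pt3_preimage
  (cphi _ (@interval_open _ (BRight a) (BLeft b) isT isT))).
Qed.

Definition reflect1 (c : R) : measurableTypeR R -> measurableTypeR R := fun a => c - a.

Lemma measurable_reflect1 c : measurable_fun setT (reflect1 c).
Proof.
apply: continuous_measurable_fun => a.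
by apply: cvgB; [exact: cvg_cst|exact: cvg_id].
Qed.

Lemma lebesgue_measure_reflect1 c (A : set R) : measurable A ->
  leb (reflect1 c @^-1` A) = leb A.
Proof.
move=> mA; pose m := measure_function_pushforward__canonical__measure_function_Measure
  leb (measurable_reflect1 c).
apply/esym; apply: (@lebesgue_measure_unique _ m) => // _ [[a b]] _ <-.
rewrite /= /pushforward.
rewrite (_ : _ @^-1` _ = `[c - b, c - a[%classic); last first.
  by apply/seteqP; split => z; rewrite /= !in_itv /= /reflect1 => /andP[? ?]; lra.
rewrite !lebesgue_measure_itv /= !lte_fin ltrD2l ltrN2; case: ifP => // _.
by congr (_%:E); ring.
Qed.

Definition reflect2 (c y : R2) : R2 := map_pair (reflect1 c.1) (reflect1 c.2) y.

Definition reflect3 (c y : RR) : RR := map_pair (reflect2 c.1) (reflect1 c.2) y.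

Lemma measurable_reflect2 c : measurable_fun [set: R2] (reflect2 c).
Proof. exact: measurable_map_pair (measurable_reflect1 _) (measurable_reflect1 _). Qed.

Lemma measurable_reflect3 c : measurable_fun [set: RR] (reflect3 c).
Proof. exact: measurable_map_pair (measurable_reflect2 _) (measurable_reflect1 _). Qed.

Lemma lebesgue_measure_reflect3 c (A : set RR) : measurable A ->
  mu (reflect3 c @^-1` A) = mu A.
Proof.
have p1 a (B : set (measurableTypeR R)) : measurable B ->
    leb (reflect1 a @^-1` B) = leb B := @lebesgue_measure_reflect1 a B.
have p2 B := @product_measure_map_pair _ _ (measurableTypeR R) (measurableTypeR R) R leb leb _ _
  (measurable_reflect1 c.1.1) (p1 _) (p1 c.1.2) B.
exact: (@product_measure_map_pair _ _ R2 (measurableTypeR R) R (leb \x leb)%E leb _ _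
  (measurable_reflect2 c.1) p2 (p1 _) A).
Qed.

Lemma Rintegral_reflect3 (c : RR) (f : RR -> R) : measurable_fun setT f ->
  mu.-integrable [set: RR] (EFin \o (f \o reflect3 c)) ->
  \int[mu]_y f y = \int[mu]_y f (reflect3 c y).
Proof.
move=> mf intf; rewrite /Rintegral; congr fine.
have mfE : measurable_fun setT (EFin \o f) by exact/measurable_EFinP.
have := @integral_pushforward _ _ _ _ _ _ (measurable_reflect3 c)
  mu setT (EFin \o f) mfE intf measurableT.
move=> /= <-.
pose m := measure_function_pushforward__canonical__measure_function_Measure
  mu (measurable_reflect3 c).
apply: (@eq_measure_integral _ _ _ _ m) => A mA _.
by apply/esym; exact: lebesgue_measure_reflect3.
Qed.

Section Filter.
Variable g : sfield R.
Hypothesis g_int : integrable_kernel g.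

(** [R] and [measurableTypeR R] have the same measurable sets but different
    displays. The integral is carried from one structure to the other as the
    integral along the identity map. *)
Lemma kernel_integrable : mu.-integrable [set: RR] (fun y => (g (pt3 y))%:E).
Proof.
pose X := [the measurableType _ of (R * R * R)%type].
pose toX (y : RR) : X := y.
have mtoX : measurable_fun [set: RR] toX by move=> mT B mB; exact: measurableI.
have [mg gfin] := integrableP _ _ _ g_int.
apply/integrableP; split; first by move=> mT B mB; exact: (mg measurableT B mB).
have := @ge0_integral_pushforward _ _ RR X R toX mtoX mu setT
  (fun y => `|(g (pt3 y))%:E|)%E measurableT.
rewrite preimage_setT => <- //; exact: measurableT_comp mg.
Qed.

Definition coords x : RR := (x 0 dir1, x 0 dir2, x 0 dir3).

Lemma pt3_coords x : pt3 (coords x) = x.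
Proof.
apply/rowP => -[[|[|[|//]]] i]; rewrite mxE /=; congr (x _ _); exact/val_inj.
Qed.

Lemma pt3_reflect3 x y : pt3 (reflect3 (coords x) y) = x - pt3 y.
Proof.
rewrite -[in RHS](pt3_coords x).
by apply/rowP => -[[|[|[|//]]] i]; rewrite !mxE.
Qed.

Lemma measurable_kernel : measurable_fun [set: RR] (fun y => g (pt3 y)).
Proof. by apply/measurable_EFinP; case/integrableP: kernel_integrable. Qed.

Lemma convolution_integrable phi x (M : R) : continuous phi ->
  (forall z, `|phi z| <= M) ->
  mu.-integrable [set: RR] (EFin \o (fun y => g (pt3 y) * phi (x - pt3 y))).
Proof.
move=> cphi bM; have M0 : 0 <= M by apply: le_trans (bM 0); exact: normr_ge0.
have := integrableZl measurableT M kernel_integrable.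
apply: le_integrable => //.
  apply/measurable_EFinP; apply: measurable_funM; first exact: measurable_kernel.
  apply: (@measurable_pt3 (fun z => phi (x - z))) => z.
  apply: (@continuous_comp _ _ _ (fun z : 'rV[R]_3 => x - z) phi); last exact: cphi.
  by apply: (@cvgB _ _ _ _ (nbhs_filter z)); [exact: cvg_cst|exact: cvg_id].
move=> y _; rewrite /= lee_fin !normrM mulrC (ger0_norm M0).
by apply: ler_wpM2r.
Qed.

(** The substitution [y := x - y] puts the translation on the field instead of
    the kernel, which makes integrability and equivariance plain. *)
Lemma convolutionE phi x (M : R) : continuous phi -> (forall z, `|phi z| <= M) ->
  \int[mu]_y (g (x - pt3 y) * phi (pt3 y))
  = \int[mu]_y (g (pt3 y) * phi (x - pt3 y)).
Proof.
move=> cphi bM.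
have E y : g (x - pt3 (reflect3 (coords x) y)) * phi (pt3 (reflect3 (coords x) y))
    = g (pt3 y) * phi (x - pt3 y) by rewrite pt3_reflect3 subKr.
rewrite (@Rintegral_reflect3 (coords x)).
- by apply: eq_Rintegral => y _; rewrite E.
- apply: measurable_funM; last exact: measurable_pt3.
  have := measurableT_comp measurable_kernel (measurable_reflect3 (coords x)).
  by apply: eq_measurable_fun => y _ /=; rewrite pt3_reflect3.
- rewrite (_ : _ \o _ = EFin \o (fun y => g (pt3 y) * phi (x - pt3 y))).
    exact: convolution_integrable bM.
  by apply/funext => y /=; rewrite E.
Qed.

Lemma convolution_averaging (ell : R) : 0 < ell -> averaging ell
  (fun phi x => \int[mu]_y (g (x - pt3 y) * phi (pt3 y))).
Proof.
move=> ell_gt0; split.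
- move=> a phi psi c1 c2; apply/funext => x.
  have [M1 b1] := cont_periodic_bounded ell_gt0 c1.
  have [M2 b2] := cont_periodic_bounded ell_gt0 c2.
  have c12 := cont_periodic_lin a c1 c2.
  have [M b] := cont_periodic_bounded ell_gt0 c12.
  rewrite (convolutionE _ c12.2 b) (convolutionE _ c1.2 b1) (convolutionE _ c2.2 b2).
  have i1 := convolution_integrable x c1.2 b1.
  have i2 := convolution_integrable x c2.2 b2.
  have ai1 := integrableZl measurableT a i1.
  rewrite -(@RintegralZl _ _ _ mu setT _ a measurableT i1).
  rewrite -(@RintegralD _ _ _ mu setT _ _ measurableT ai1 i2).
  by apply: eq_Rintegral => y _; ring.
- move=> phi z c; apply/funext => x.
  have [M b] := cont_periodic_bounded ell_gt0 c.
  rewrite (convolutionE (x + z) c.2 b).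
  rewrite (convolutionE x (cont_periodic_shift z c).2 (fun w => b (w + z))).
  by apply: eq_Rintegral => y _; rewrite addrAC.
- pose C := \int[mu]_y `|g (pt3 y)|; exists (C + 1).
    by rewrite ltr_wpDl // Rintegral_ge0.
  move=> phi M c b x.
  have M0 : 0 <= M by apply: le_trans (b 0); exact: normr_ge0.
  have i := convolution_integrable x c.2 b.
  have ig : mu.-integrable [set: RR] (EFin \o (fun y => `|g (pt3 y)|)).
    exact: integrable_norm kernel_integrable.
  have igM := integrableZl measurableT M ig.
  rewrite (convolutionE x c.2 b).
  apply: le_trans (@le_normr_Rintegral _ _ _ mu setT _ measurableT i) _.
  apply: (@le_trans _ _ (\int[mu]_y (M * `|g (pt3 y)|))).
    apply: (@le_Rintegral _ _ _ mu) => //.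
      exact: integrable_norm i.
    by move=> y _ /=; rewrite normrM mulrC ler_wpM2r.
  rewrite (@RintegralZl _ _ _ mu setT _ M measurableT ig).
  by rewrite mulrC ler_wpM2r // -/C lerDl.
Qed.

End Filter.

Lemma convfilter_averaging (ell Delta : R) (G : R -> sfield R) : 0 < ell -> 0 <= Delta ->
  (forall D : R, 0 < D -> integrable_kernel (G D)) ->
  averaging ell (convfilter G Delta).
Proof.
move=> ell_gt0 D0 Gint; rewrite /convfilter; case: eqP => [_|/eqP Dn0].
  exact: averaging_id.
by apply: convolution_averaging => //; apply: Gint; rewrite lt_def Dn0.
Qed.

End Convolution.

(** * Regularity of the stress *)

Section StressRegularity.
Variables (R : realType) (ell : R).
Local Notation cont_periodic := (@cont_periodic R ell).
Local Notation C1_periodic := (@C1_periodic R ell).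
Implicit Types (phi psi : sfield R) (x y : 'rV[R]_3).

Lemma pd_periodic k phi : Defs.periodic ell phi -> Defs.periodic ell (pd k phi).
Proof.
move=> per i x; rewrite /pd /derive; set f := (X in lim (X @ _) = _).
rewrite (_ : f = fun d => d^-1 *: (phi (d *: unitv R k + x) - phi x)) //.
by apply/funext => d; rewrite /f /= per addrA per.
Qed.

Lemma U_pd k phi : U ell phi -> U ell (pd k phi).
Proof.
move=> [per sm]; split; first exact: pd_periodic.
by move=> l; have := sm (rcons l k); rewrite foldr_rcons.
Qed.

Lemma U_C1 phi : U ell phi -> C1_periodic phi.
Proof.
move=> Uphi; have UC psi : U ell psi -> cont_periodic psi.
  by move=> [per /(_ [::])[]].
split=> [|k]; first exact: UC.
split; last exact/UC/U_pd.
by move=> x; have [_ /(_ [::])[_]] := Uphi; exact.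
Qed.

Lemma U0 : U ell (fun=> 0).
Proof.
split=> [i x //|l]; have -> : foldr (@pd R) (fun=> 0) l = (fun=> 0) :> sfield R.
  by elim: l => //= i l ->; apply/funext => x; rewrite /pd derive_cst.
split; first exact: cst_continuous.
by move=> i x; exact: derivable_cst.
Qed.

(** The selected value is a solution, which belongs to [U], or the zero field. *)
Lemma laplacian_inv_U phi : U ell (laplacian_inv ell phi).
Proof. by rewrite /laplacian_inv; case: xgetP => [p _ []|_] //; exact: U0. Qed.

Lemma C1_is_derive phi k x : C1_periodic phi ->
  is_derive x (unitv R k) phi (pd k phi x).
Proof. by move=> [_ /(_ k)[d _]]; apply: DeriveDef. Qed.

Lemma C1_intro phi (dphi : 'I_3 -> sfield R) : cont_periodic phi ->
  (forall k x, is_derive x (unitv R k) phi (dphi k x)) ->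
  (forall k, cont_periodic (dphi k)) -> C1_periodic phi.
Proof.
move=> cp d cd; split=> // k; split=> [x|]; first by case: (d k x).
rewrite (_ : pd k phi = dphi k) //.
by apply/funext => x; have [_] := d k x.
Qed.

Lemma C1_lin (a : R) phi psi : C1_periodic phi -> C1_periodic psi ->
  C1_periodic (fun x => a * phi x + psi x).
Proof.
move=> c1 c2; apply: (@C1_intro _ (fun k x => a * pd k phi x + pd k psi x)).
- by apply: cont_periodic_lin; [exact: c1.1|exact: c2.1].
- by move=> k x; exact: is_deriveD (is_deriveZ a (C1_is_derive k x c1)) (C1_is_derive k x c2).
- by move=> k; apply: cont_periodic_lin; [exact: (c1.2 k).2|exact: (c2.2 k).2].
Qed.

Lemma cont_periodicM phi psi : cont_periodic phi -> cont_periodic psi ->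
  cont_periodic (fun x => phi x * psi x).
Proof.
move=> [p1 c1] [p2 c2]; split; first by move=> i x; rewrite p1 p2.
by move=> x; exact: cvgM (c1 x) (c2 x).
Qed.

Lemma C1M phi psi : C1_periodic phi -> C1_periodic psi ->
  C1_periodic (fun x => phi x * psi x).
Proof.
move=> c1 c2.
apply: (@C1_intro _ (fun k x => 1 * (phi x * pd k psi x) + psi x * pd k phi x)).
- by apply: cont_periodicM; [exact: c1.1|exact: c2.1].
- move=> k x; rewrite mul1r.
  exact: is_deriveM (C1_is_derive k x c1) (C1_is_derive k x c2).
- move=> k; apply: cont_periodic_lin; apply: cont_periodicM.
  + exact: c1.1.
  + exact: (c2.2 k).2.
  + exact: c2.1.
  + exact: (c1.2 k).2.
Qed.

Lemma C1_0 : C1_periodic (fun=> 0).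
Proof. exact/U_C1/U0. Qed.

Lemma C1_sum (J : finType) (F : J -> sfield R) :
  (forall j, C1_periodic (F j)) -> C1_periodic (fun x => \sum_j F j x).
Proof.
move=> c; rewrite (_ : (fun x => _) = \sum_j F j); last first.
  by apply/funext => x; rewrite fct_sumE.
apply: (big_ind (fun phi : sfield R => C1_periodic phi)) => [|f g cf cg|j _].
- exact: C1_0.
- rewrite (_ : f + g = fun x => 1 * f x + g x); first exact: C1_lin.
  by apply/funext => x; rewrite mul1r.
- exact: c.
Qed.

(** Every term of the stress is a product or a derivative of fields of [U], or a
    pressure, which is again in [U]. *)
Lemma stress_C1 nu (u : vfield R) i j : (forall k, U ell (u k)) ->
  C1_periodic (stress ell nu u i j).
Proof.
move=> Uu; have cu k := U_C1 (Uu k); have cdu k l := U_C1 (U_pd l (Uu k)).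
apply: C1_sum => a; apply: C1_sum => b.
have cs : C1_periodic (sigma nu u a b).
  rewrite (_ : sigma _ _ _ _ = fun x => - nu * pd b (u a) x
      + (- nu * pd a (u b) x + u a x * u b x)).
    by apply: C1_lin => //; apply: C1_lin => //; exact: C1M.
  by apply/funext => x; rewrite /sigma; ring.
rewrite (_ : tproj _ _ _ _ _ _ = fun x => (kron R i a * kron R j b) * sigma nu u a b x
   + (- kron R i j * laplacian_inv ell (pd a (pd b (sigma nu u a b))) x + 0)).
  apply: C1_lin => //; apply: C1_lin; last exact: C1_0.
  exact/U_C1/laplacian_inv_U.
by apply/funext => x; rewrite /tproj; ring.
Qed.

End StressRegularity.

(** * Discrete projectors *)

Section DiscreteProjection.
Variables (R : realType) (n : nat) (ell h : R).
Hypothesis ellE : ell = h * n.+1%:R.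
Local Notation grid := {ffun 'I_3 -> 'I_n.+1}.
Implicit Types (phi : sfield R) (w : vfield R) (s : tfield R).
Variable K : grid -> R.
Hypothesis KE : forall phi, Defs.periodic ell phi ->
  (forall x, grid_average h n.+1 phi x = 0) ->
  laplacianh_inv ell h n.+1 phi = grid_conv h K phi.

Lemma sum_kron (i : 'I_3) (F : 'I_3 -> R) : \sum_j kron R i j * F j = F i.
Proof.
rewrite (bigD1 i) //= big1 => [|j /negPf ji]; last first.
  by rewrite /kron eq_sym ji mul0r.
by rewrite /kron eqxx mul1r addr0.
Qed.

Lemma laplacianh_inv_pdh i phi : Defs.periodic ell phi ->
  laplacianh_inv ell h n.+1 (pdh h i phi) = grid_conv h K (pdh h i phi).
Proof.
move=> per; apply: KE => [|x]; first exact: pdh_periodic.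
by apply: grid_average_pdh; rewrite -ellE.
Qed.

Lemma sigmah_periodic nu w i j : (forall k, Defs.periodic ell (w k)) ->
  Defs.periodic ell (sigmah nu h w i j).
Proof.
move=> per; have eta k l : Defs.periodic ell (etah h k (w l)).
  by move=> m x; rewrite /etah addrAC per [X in _ + w l X]addrAC per.
by move=> m x; rewrite /sigmah !eta !(pdh_periodic _ _ (per _)).
Qed.

Definition divh w : sfield R := fun x => \sum_j pdh h j (w j) x.

Definition double_divh s : sfield R :=
  fun x => \sum_a \sum_b pdh h a (pdh h b (s a b)) x.

(** By linearity of the Green's convolution the pressures of the components add
    up to the one pressure of the whole divergence. *)
Lemma vprojh_sumE w i x : (forall j, Defs.periodic ell (w j)) ->
  \sum_j vprojh ell h n.+1 i j (w j) x
  = w i x - pdh h i (grid_conv h K (divh w)) x.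
Proof.
move=> per; rewrite sumrB sum_kron; congr (_ - _).
rewrite grid_conv_sum pdh_sum; apply: eq_bigr => j _.
by rewrite laplacianh_inv_pdh.
Qed.

Lemma tprojh_applyE s i j : (forall a b, Defs.periodic ell (s a b)) ->
  tprojh_apply ell h n.+1 s i j
  = fun x => s i j x - kron R i j * grid_conv h K (double_divh s) x.
Proof.
move=> per; apply/funext => x; rewrite /tprojh_apply /tprojh.
under eq_bigr do rewrite sumrB; rewrite sumrB; congr (_ - _).
  under eq_bigr do under eq_bigr do rewrite -mulrA.
  under eq_bigr do rewrite -mulr_sumr sum_kron.
  by rewrite sum_kron.
rewrite grid_conv_sum mulr_sumr; apply: eq_bigr => a _.
rewrite grid_conv_sum mulr_sumr; apply: eq_bigr => b _.
by rewrite laplacianh_inv_pdh //; exact: pdh_periodic.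
Qed.

(** Only the diagonal entries of the projected tensor carry the pressure, so its
    row divergence is the row divergence of the tensor minus a discrete
    gradient. *)
Lemma divh_tprojh_apply s i x : (forall a b, Defs.periodic ell (s a b)) ->
  \sum_j pdh h j (tprojh_apply ell h n.+1 s i j) x
  = divh (s i) x - pdh h i (grid_conv h K (double_divh s)) x.
Proof.
move=> per; under eq_bigr do rewrite tprojh_applyE // pdhB pdhZ.
by rewrite sumrB sum_kron.
Qed.

Lemma divhB w w' : divh (fun j x => w j x - w' j x) = fun x => divh w x - divh w' x.
Proof. by apply/funext => x; rewrite /divh -sumrB; apply: eq_bigr => j _; rewrite pdhB. Qed.

Lemma double_divhB s s' : double_divh (fun a b x => s a b x - s' a b x)
  = fun x => double_divh s x - double_divh s' x.
Proof.
apply/funext => x; rewrite /double_divh -sumrB; apply: eq_bigr => a _.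
by rewrite -sumrB; apply: eq_bigr => b _; rewrite !pdhB.
Qed.

Lemma divh_divh s : divh (fun a => divh (s a)) = double_divh s.
Proof. by apply/funext => x; apply: eq_bigr => a _; rewrite pdh_sum. Qed.

Lemma is_derive_pdh (W : R -> sfield R) (D : sfield R) (t : R) i x :
  (forall y, is_derive t 1 (fun s : R => W s y) (D y)) ->
  is_derive t 1 (fun s : R => pdh h i (W s) x) (pdh h i D x).
Proof.
move=> d; have dB := is_deriveB (d (x + (h / 2) *: unitv R i)) (d (x - (h / 2) *: unitv R i)).
exact: (is_deriveZ h^-1 dB).
Qed.

Lemma is_derive_finsum (J : finType) (f : J -> R -> R) (df : J -> R) (t : R) :
  (forall j, is_derive t 1 (f j) (df j)) ->
  is_derive t 1 (fun s : R => \sum_j f j s) (\sum_j df j).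
Proof.
move=> d; rewrite (_ : (fun s : R => _) = \sum_j f j); last first.
  by apply/funext => s; rewrite fct_sumE.
apply: (big_ind2 (fun (g : R -> R) dg => is_derive t 1 g dg)) => [|g dg g' dg' d1 d2|j _].
- exact: is_derive_cst.
- exact: is_deriveD.
- exact: d.
Qed.

Lemma is_derive_grid_conv (W : R -> sfield R) (D : sfield R) (t : R) x :
  (forall y, is_derive t 1 (fun s : R => W s y) (D y)) ->
  is_derive t 1 (fun s : R => grid_conv h K (W s) x) (grid_conv h K D x).
Proof. by move=> d; apply: is_derive_finsum => m; exact: (is_deriveZ (K m) (d _)). Qed.

Lemma is_derive_divh (W : R -> vfield R) (D : vfield R) (t : R) x :
  (forall j y, is_derive t 1 (fun s : R => W s j y) (D j y)) ->
  is_derive t 1 (fun s : R => divh (W s) x) (divh D x).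
Proof.
move=> d.
exact: is_derive_finsum (fun j => is_derive_pdh (W := fun s : R => W s j) _ _ (d j)).
Qed.

End DiscreteProjection.

(** * The filtered and projected equations *)

Section FilteredMomentum.
Variables (R : realType) (ell nu h : R) (F : sfield R -> sfield R).
Variables (I : set R) (u : R -> vfield R).
Hypotheses (ell_gt0 : 0 < ell) (h_gt0 : 0 < h) (avgF : averaging ell F).
Hypotheses (I_open : open I) (u_U : forall t i, I t -> U ell (u t i)).
Hypotheses (u_time : time_regular I u) (u_NS : navier_stokes ell nu I u).

(** The filters pass through the time derivative, and the box average of the
    exact divergence is the discrete divergence of the face averages. *)
Lemma filtered_momentum t j y : I t ->
  is_derive t 1 (fun s => volfilter h (F (u s j)) y)
    (- divh h (fun k => surffilter h k (F (stress ell nu (u t) j k))) y).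
Proof.
move=> It; pose T := volfilter h \o F.
have near_I : \forall s \near t, I s by exact: open_nbhs_nbhs.
have avgT : averaging ell T.
  exact: (averaging_comp ell_gt0 (volfilter_averaging ell_gt0 h_gt0) avgF).
pose r s := stress ell nu (u s).
have rC1 s k : I s -> C1_periodic ell (r s j k).
  by move=> Is; apply: stress_C1 => l; exact: u_U.
pose Psi s : sfield R := fun z => derive1 (fun q => u q j z) s.
have PsiE s : I s -> Psi s = fun z => - \sum_(k < 3) pd k (r s j k) z.
  move=> Is; apply/funext => z; have [_ /(_ j) ns] := u_NS z Is.
  by apply/eqP; rewrite -addr_eq0; exact/eqP.
have PsiC s : I s -> cont_periodic ell (Psi s).
  move=> Is; rewrite PsiE //; apply/cont_periodicN/cont_periodic_sum => k.
  by case: (rC1 s k Is) => _ /(_ k)[].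
rewrite (_ : - divh _ _ _ = T (Psi t) y); last first.
  have rC k := (((rC1 t k It).2 k).2).
  rewrite PsiE // (averagingN avgT); last exact: cont_periodic_sum.
  rewrite (averaging_sum avgT) //; congr (- _); apply: eq_bigr => k _.
  rewrite /T /= -(pd_averaging ell_gt0 k avgF (rC1 t k It)).
  by rewrite (volfilter_pd ell_gt0 h_gt0 k (averaging_C1 ell_gt0 avgF (rC1 t k It))).
suff : is_derive t 1 (fun s => T (u s j) y) (T (Psi t) y) by [].
apply: (averaging_derive_param ell_gt0 (Phi := fun s => u s j) (Psi := Psi)) => //.
- by near=> s; apply: (U_C1 (u_U _ _)).1; near: s.
- exact: PsiC.
- near=> s => z; have Is : I s by near: s.
  have [d _] := u_time j z Is.
  by apply: DeriveDef => //; rewrite /Psi derive1E.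
- by near=> s; apply: (PsiC s _).1; near: s.
- by move=> z; have [_] := u_time j z It.
Unshelve. all: by end_near. Qed.

End FilteredMomentum.

Unset Implicit Arguments.

Theorem mainTheorem2 (R : realType) (ell nu Delta h : R) (N : nat)
    (G : R -> sfield R) (I : set R) (u : R -> vfield R)
    (ell_gt0 : 0 < ell) (nu_gt0 : 0 < nu) (Delta_ge0 : 0 <= Delta)
    (N_gt0 : (0 < N)%N) (hE : h = ell / N%:R)
    (G_int : forall D : R, 0 < D -> integrable_kernel (G D))
    (I_open : open I)
    (u_U : forall t i, I t -> U ell (u t i))
    (u_time : time_regular I u)
    (u_NS : navier_stokes ell nu I u) :
  forall (t : R) (x : 'rV[R]_3) (i : 'I_3), I t ->
    let v := fun s => ubar ell h N G Delta (u s) in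
    derivable (fun s => v s i x) t 1 /\
    derive1 (fun s => v s i x) t
    + \sum_(j < 3) pdh h j (tprojh_apply ell h N (sigmah nu h (v t)) i j) x
    = - \sum_(j < 3)
          pdh h j (tprojh_apply ell h N (xi ell nu h N G Delta (u t)) i j) x.
Proof.
move=> t x i It v; case: N N_gt0 hE @v => // n _ hE v.
have N0 : n.+1%:R != 0 :> R by rewrite pnatr_eq0.
have h_gt0 : 0 < h by rewrite hE divr_gt0 // ltr0n.
have ellE : ell = h * n.+1%:R by rewrite hE divfK.
have [K KE] : exists K : {ffun 'I_3 -> 'I_n.+1} -> R, forall phi,
    Defs.periodic ell phi -> (forall x, grid_average h n.+1 phi x = 0) ->
    laplacianh_inv ell h n.+1 phi = grid_conv h K phi.
  by rewrite ellE; apply: laplacianh_inv_green; rewrite gt_eqF.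
have near_I : \forall s \near t, I s by exact: open_nbhs_nbhs.
pose F := convfilter G Delta; pose T := volfilter h \o F.
have avgF : averaging ell F by exact: convfilter_averaging.
have avgT : averaging ell T.
  exact: (averaging_comp ell_gt0 (volfilter_averaging ell_gt0 h_gt0) avgF).
have uC s j : I s -> cont_periodic ell (u s j) by move=> Is; case: (U_C1 (u_U s j Is)).
pose S : tfield R := fun j k => surffilter h k (F (stress ell nu (u t) j k)).
have ubarC s j : I s -> cont_periodic ell (T (u s j)).
  by move=> Is; apply: averaging_cont_periodic => //; exact: uC.
have SC j k : cont_periodic ell (S j k).
  apply: averaging_cont_periodic => //; first exact: surffilter_averaging.
  apply: averaging_cont_periodic => //.
  by case: (stress_C1 nu j k (fun l => u_U t l It)).
have mom j y : is_derive t 1 (fun s => T (u s j) y) (- divh h (S j) y).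
  exact: (filtered_momentum ell_gt0 h_gt0 avgF I_open u_U u_time u_NS j y It).
(* For [s] outside [I] the field may fail to be periodic, so this formula is
   available only for times near [t]. *)
have vE s j : I s ->
    v s j = fun y => T (u s j) y - pdh h j (grid_conv h K (divh h (fun k => T (u s k)))) y.
  move=> Is; apply/funext => y.
  by apply: (vprojh_sumE ellE KE (w := fun k => T (u s k))) => k; case: (ubarC s k Is).
have xiE : xi ell nu h n.+1 G Delta (u t) = fun a b y => S a b y - sigmah nu h (v t) a b y.
  by [].
(* The rest is discrete algebra on abstract periodic fields. *)
clearbody v S T.
have vper j : Defs.periodic ell (v t j).
  rewrite (vE t j It) => k y; congr (_ - _); first exact: (ubarC t j It).1.
  have per : Defs.periodic ell (divh h (fun k => T (u t k))).
    by move=> l z; apply: eq_bigr => m _; exact: (pdh_periodic _ _ (ubarC t m It).1).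
  exact: (pdh_periodic _ _ (grid_conv_periodic _ _ per)).
set sg := sigmah nu h (v t) in xiE *.
have sgper a b : Defs.periodic ell (sg a b) by exact: sigmah_periodic.
have Sper a b : Defs.periodic ell (S a b) by exact: (SC a b).1.
pose q := grid_conv h K (double_divh h S).
have dv : is_derive t 1 (fun s => v s i x) (- divh h (S i) x + pdh h i q x).
  have -> : - divh h (S i) x + pdh h i q x = - divh h (S i) x
      - pdh h i (grid_conv h K (divh h (fun k y => - divh h (S k) y))) x.
    have -> : divh h (fun k y => - divh h (S k) y) = fun y => - double_divh h S y.
      rewrite -divh_divh; apply/funext => y; rewrite /divh -sumrN.
      by apply: eq_bigr => k _; rewrite pdhN.
    by rewrite grid_convN pdhN opprK.
  pose V s := T (u s i) x - pdh h i (grid_conv h K (divh h (fun k => T (u s k)))) x.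
  apply: (@near_eq_is_derive _ _ _ V).
    by near=> s; rewrite vE //; near: s.
  have d1 y := is_derive_divh h y mom.
  have d2 y := is_derive_grid_conv h K y d1.
  exact: (is_deriveB (mom i x) (is_derive_pdh h i x d2)).
split; first by case: dv.
have -> : derive1 (fun s => v s i x) t = - divh h (S i) x + pdh h i q x.
  by rewrite derive1E; case: dv.
(* The numerical stress enters both sides through the same linear operator and
   cancels. *)
rewrite xiE !(divh_tprojh_apply ellE KE) => // [|a b k y]; last by rewrite Sper sgper.
by rewrite double_divhB grid_convB pdhB divhB -/q; ring.
Unshelve. all: by end_near. Qed.
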